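(* If $n$ is large enough, then every $p\in S_n$ has a monotone $2$-multiplicative subsequence of length three.
   Context: $S_n$ denotes the set of permutations of $\{1,2,\ldots,n\}$ written in one-line notation $p=(p_1,p_2,\ldots,p_n)$. A subsequence of $p$ of length $k$ is a sequence $(p_{i_1},\ldots,p_{i_k})$ with $i_1<\cdots<i_k$. A sequence is monotone if it is increasing or decreasing. A sequence $(a_1,a_2,\ldots,a_k)$ of positive integers is $2$-multiplicative if $a_1a_2\cdots a_k=a_1^2$ or $a_1a_2\cdots a_k=a_k^2$. *)

(* Defs.v *)
From mathcomp Require Import all_boot all_fingroup.

Set Implicit Arguments.
Unset Strict Implicit.
Unset Printing Implicit Defensive.

(* 'S_n permutes 'I_n = {0, ..., n - 1}; the successor shifts the values to
   {1, ..., n}. *)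
Definition one_line (n : nat) (p : 'S_n) : seq nat :=
  [seq (nat_of_ord (p i)).+1 | i <- enum 'I_n].

Definition monotone_seq (a : seq nat) : bool := sorted ltn a || sorted gtn a.

(* The default 0 of [head] and [last] is only reached on the empty sequence,
   which is not 2-multiplicative since its product is 1. *)
Definition two_multiplicative (a : seq nat) : Prop :=
  all (fun x => 0 < x) a /\
  (\prod_(x <- a) x = head 0 a ^ 2 \/ \prod_(x <- a) x = last 0 a ^ 2).

(* Main.v *)
Require Import Defs.
From mathcomp Require Import all_boot all_fingroup.
From mathcomp Require Import zify.

(** Restricting to the values [2 ^ 1, ..., 2 ^ 22] turns products into sums.
    If [x < y] and the entry [2 ^ y] of [p] stands between the entries [2 ^ x]
    and [2 ^ (x + y)], then these three entries form a monotone subsequence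
    whose product is [(2 ^ (x + y)) ^ 2], where [2 ^ (x + y)] is its first or
    its last term.  So it suffices to show that every linear order on
    [1, ..., 22] puts some [y] between [x] and [x + y], with [0 < x < y]
    ([additive_triple]); the positions of the powers of 2 in [p] give such a
    linear order, as soon as [n >= 2 ^ 22].

    Suppose that a linear order on [1, ..., 22] has no such [y].  Then each
    [y] lies on the same side of [x] and of [x + y], so a single comparison
    of [x] and [y] settles that of [x + y] and [y], which in turn settles that
    of [x + y] and [x + 2 y], and so on; transitivity then spreads the
    information.  Up to reversing the order, 1 comes before 2.  Knowing in
    addition whether 1 comes before 3 and, if not, whether 1 comes before 4,
    is enough to derive two contradictory comparisons
    ([no_avoiding_order]). *)

(** The last hypothesis says that [y] is never between [x] and [x + y]: as the
    order is linear, it also gives the equality of [before y x] and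
    [before y (x + y)].  In each of the three cases, according to the places
    of 3 and 4 relative to 1, chains of forced comparisons end in a
    contradiction.  In the comments on these chains, [i -> j] stands for
    [before i j]. *)
Lemma no_avoiding_order (before : rel nat) :
  transitive before ->
  {in [pred k | 0 < k <= 22] &, forall x y,
    x != y -> before y x = ~~ before x y} ->
  (forall x y, 0 < x -> x < y -> x + y <= 22 ->
    before x y = before (x + y) y) ->
  ~~ before 1 2.
Proof.
move=> before_tr before_neg same_side; apply/negP => b1_2.
have before_trans x y z : before x y -> before y z -> before x z.
  by move=> bxy byz; apply: before_tr bxy byz.
have same_side' x y : 0 < x -> x < y -> x + y <= 22 ->
    before y x = before y (x + y).
  move=> x_gt0 ltxy le_xy_22; have y_gt0 := ltn_trans x_gt0 ltxy.
  have neg := before_neg _ y _ _; rewrite !neg ?inE -?same_side //; lia.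
have add_before x y : before x y -> 0 < x -> x < y -> x + y <= 22 ->
  before (x + y) y by move=> ? *; rewrite -same_side.
have add_after x y : before y x -> 0 < x -> x < y -> x + y <= 22 ->
  before y (x + y) by move=> ? *; rewrite -same_side'.
have sub_before x y : before (x + y) y -> 0 < x -> x < y -> x + y <= 22 ->
  before x y by move=> ? *; rewrite same_side.
have sub_after x y : before y (x + y) -> 0 < x -> x < y -> x + y <= 22 ->
  before y x by move=> ? *; rewrite same_side'.
have b3_2 : before 3 2 by exact: (add_before 1 2).
have b3_5 : before 3 5 by exact: (add_after 2 3).
have b8_5 : before 8 5 by exact: (add_before 3 5).
have b8_13 : before 8 13 by exact: (add_after 5 8).
case b1_3: (before 1 3).
  (* From 6 -> 11 -> 7 follow 13 -> 7, hence 8 -> 13 -> 20, and 6 -> 1 -> 3,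
     hence 6 -> 9 -> 14 and 20 -> 14.  So 8 is before 14. *)
  have b1_5 : before 1 5 by exact: before_trans b1_3 b3_5.
  have b6_5 : before 6 5 by exact: (add_before 1 5).
  have b6_11 : before 6 11 by exact: (add_after 5 6).
  have b4_3 : before 4 3 by exact: (add_before 1 3).
  have b4_7 : before 4 7 by exact: (add_after 3 4).
  have b11_7 : before 11 7 by exact: (add_before 4 7).
  have b6_7 : before 6 7 by exact: before_trans b6_11 b11_7.
  have b13_7 : before 13 7 by exact: (add_before 6 7).
  have b13_20 : before 13 20 by exact: (add_after 7 13).
  have b8_20 : before 8 20 by exact: before_trans b8_13 b13_20.
  have b6_1 : before 6 1 by exact: (sub_after 1 6).
  have b6_3 : before 6 3 by exact: before_trans b6_1 b1_3.
  have b6_9 : before 6 9 by exact: (add_after 3 6).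
  have b4_5 : before 4 5 by exact: before_trans b4_3 b3_5.
  have b9_5 : before 9 5 by exact: (add_before 4 5).
  have b9_14 : before 9 14 by exact: (add_after 5 9).
  have b6_14 : before 6 14 by exact: before_trans b6_9 b9_14.
  have b20_14 : before 20 14 by exact: (add_before 6 14).
  have b8_14 : before 8 14 by exact: before_trans b8_20 b20_14.
  (* On the other hand 6 -> 1 -> 2 pulls 14 = 6 + 8 before 8. *)
  have b6_2 : before 6 2 by exact: before_trans b6_1 b1_2.
  have b6_8 : before 6 8 by exact: (add_after 2 6).
  have b14_8 : before 14 8 by exact: (add_before 6 8).
  by rewrite (before_neg 14 8) ?b14_8 in b8_14.
have b3_1 : before 3 1 by rewrite (before_neg 1 3) ?b1_3.
have b3_4 : before 3 4 by exact: (add_after 1 3).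
case b1_4: (before 1 4).
  (* The chain 12 -> 21 -> 13 puts 12 before 13 = 1 + 12, hence before 1. *)
  have b5_4 : before 5 4 by exact: (add_before 1 4).
  have b8_4 : before 8 4 by exact: before_trans b8_5 b5_4.
  have b8_12 : before 8 12 by exact: (add_after 4 8).
  have b20_12 : before 20 12 by exact: (add_before 8 12).
  have b5_9 : before 5 9 by exact: (add_after 4 5).
  have b3_9 : before 3 9 by exact: before_trans b3_5 b5_9.
  have b12_9 : before 12 9 by exact: (add_before 3 9).
  have b12_21 : before 12 21 by exact: (add_after 9 12).
  have b21_13 : before 21 13 by exact: (add_before 8 13).
  have b12_13 : before 12 13 by exact: before_trans b12_21 b21_13.
  have b12_1 : before 12 1 by exact: (sub_after 1 12).
  have b12_2 : before 12 2 by exact: before_trans b12_1 b1_2.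
  have b12_14 : before 12 14 by exact: (add_after 2 12).
  (* Now 20 -> 12 -> 14 and 20 = 6 + 14 give 6 -> 14 -> 9, so 6 precedes
     3. *)
  have b20_14 : before 20 14 by exact: before_trans b20_12 b12_14.
  have b6_14 : before 6 14 by exact: (sub_before 6 14).
  have b14_9 : before 14 9 by exact: (add_before 5 9).
  have b6_9 : before 6 9 by exact: before_trans b6_14 b14_9.
  have b6_3 : before 6 3 by exact: (sub_after 3 6).
  (* But 8 -> 12 -> 14 and 14 = 6 + 8 give 8 -> 6, hence 3 -> 2 -> 6. *)
  have b8_14 : before 8 14 by exact: before_trans b8_12 b12_14.
  have b8_6 : before 8 6 by exact: (sub_after 6 8).
  have b2_6 : before 2 6 by exact: (sub_before 2 6).
  have b3_6 : before 3 6 by exact: before_trans b3_2 b2_6.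
  by rewrite (before_neg 3 6) ?b3_6 in b6_3.
have b4_1 : before 4 1 by rewrite (before_neg 1 4) ?b1_4.
(* The chain 9 -> 15 -> 8 -> 13 puts 9 before 13 = 4 + 9, hence before 4. *)
have b4_2 : before 4 2 by exact: before_trans b4_1 b1_2.
have b4_6 : before 4 6 by exact: (add_after 2 4).
have b3_6 : before 3 6 by exact: before_trans b3_4 b4_6.
have b9_6 : before 9 6 by exact: (add_before 3 6).
have b9_15 : before 9 15 by exact: (add_after 6 9).
have b7_4 : before 7 4 by exact: (add_before 3 4).
have b7_1 : before 7 1 by exact: before_trans b7_4 b4_1.
have b7_8 : before 7 8 by exact: (add_after 1 7).
have b15_8 : before 15 8 by exact: (add_before 7 8).
have b15_13 : before 15 13 by exact: before_trans b15_8 b8_13.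
have b9_13 : before 9 13 by exact: before_trans b9_15 b15_13.
have b9_4 : before 9 4 by exact: (sub_after 4 9).
(* But 10 -> 16 -> 9 and 10 = 1 + 9 give 4 -> 1 -> 9. *)
have b10_6 : before 10 6 by exact: (add_before 4 6).
have b10_16 : before 10 16 by exact: (add_after 6 10).
have b7_2 : before 7 2 by exact: before_trans b7_4 b4_2.
have b7_9 : before 7 9 by exact: (add_after 2 7).
have b16_9 : before 16 9 by exact: (add_before 7 9).
have b10_9 : before 10 9 by exact: before_trans b10_16 b16_9.
have b1_9 : before 1 9 by exact: (sub_before 1 9).
have b4_9 : before 4 9 by exact: before_trans b4_1 b1_9.
by rewrite (before_neg 4 9) ?b4_9 in b9_4.
Qed.

(** Without such [x] and [y], the order by increasing [f] and the order by
    decreasing [f] would both fall under [no_avoiding_order], although one of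
    them puts 1 before 2.  The quantifiers range over ['I_23] because the
    argument is by contradiction. *)
Lemma additive_triple (f : nat -> nat) :
  {in [pred k | 0 < k <= 22] &, injective f} ->
  exists x y, [/\ 0 < x, x < y, x + y <= 22 &
    f x < f y < f (x + y) \/ f (x + y) < f y < f x].
Proof.
move=> f_inj.
pose between x y := (f x < f y < f (x + y)) || (f (x + y) < f y < f x).
have [/existsP[x /existsP[y /and4P[x_gt0 ltxy le_xy_22 /orP bxy]]]|noP] :=
    boolP [exists x : 'I_23, exists y : 'I_23,
             [&& 0 < x, x < y, x + y <= 22 & between x y]].
  by exists x, y.
have avoid x y : 0 < x -> x < y -> x + y <= 22 -> ~~ between x y.
  move=> x_gt0 ltxy le_xy_22; apply: contra noP => bxy.
  have x_lt : x < 23 by lia.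
  have y_lt : y < 23 by lia.
  apply/existsP; exists (Ordinal x_lt); apply/existsP; exists (Ordinal y_lt).
  exact/and4P.
have f_neq x y : 0 < x <= 22 -> 0 < y <= 22 -> x != y -> f x != f y.
  by move=> ? ?; apply: contra_neq; apply: f_inj.
have not12 : ~~ (f 1 < f 2).
  apply: (no_avoiding_order (fun x y => f x < f y)) => [y x z|x y|x y].
  - exact: ltn_trans.
  - by rewrite !inE => xP yP neq_xy; have := f_neq _ _ xP yP neq_xy; lia.
  - move=> x_gt0 ltxy le_xy_22; have := avoid _ _ x_gt0 ltxy le_xy_22.
    have := f_neq x y; have := f_neq (x + y) y; rewrite /between; lia.
have not21 : ~~ (f 2 < f 1).
  apply: (no_avoiding_order (fun x y => f y < f x)) => [y x z /[swap]|x y|x y].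
  - exact: ltn_trans.
  - by rewrite !inE => xP yP neq_xy; have := f_neq _ _ xP yP neq_xy; lia.
  - move=> x_gt0 ltxy le_xy_22; have := avoid _ _ x_gt0 ltxy le_xy_22.
    have := f_neq x y; have := f_neq (x + y) y; rewrite /between; lia.
by have := f_neq 1 2 isT isT isT; lia.
Qed.

(** Up to the injection [nth x0 s], the claim is that the increasing sequence
    of indices of [t] is a subsequence of [iota 0 (size s)]. *)
Lemma subseq_sorted_index (T : eqType) (s t : seq T) :
  {subset t <= s} -> sorted ltn [seq index x s | x <- t] -> subseq t s.
Proof.
move=> sts idx_sorted.
case: t => [|x0 t'] in sts idx_sorted *; first exact: sub0seq.
set t := x0 :: t' in sts idx_sorted *; set idx := map _ _ in idx_sorted.
have -> : t = map (nth x0 s) idx.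
  by rewrite -map_comp map_id_in // => x /sts x_s; apply: nth_index.
rewrite -[X in subseq _ X](mkseq_nth x0) /mkseq; apply: map_subseq.
suff -> : idx = [seq i <- iota 0 (size s) | i \in idx] by apply: filter_subseq.
apply: (irr_sorted_eq ltn_trans ltnn) => // [|i].
  by apply: sorted_filter (iota_ltn_sorted _ _); apply: ltn_trans.
rewrite mem_filter mem_iota; apply/idP/andP => [i_idx|[]//]; split=> //.
by case/mapP: i_idx => x /sts x_s ->; rewrite index_mem.
Qed.

Lemma multiplicative_triple (s : seq nat) :
  (forall k, 0 < k <= 22 -> 2 ^ k \in s) ->
  exists a : seq nat,
    [/\ subseq a s, size a = 3, monotone_seq a & two_multiplicative a].
Proof.
move=> pow_s.
have pos_inj : {in [pred k | 0 < k <= 22] &,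
    injective (fun k => index (2 ^ k) s)}.
  move=> i j iP jP /(index_inj 0 (pow_s i iP) (pow_s j jP)) eq_pow.
  by apply/eqP; rewrite -(eqn_exp2l i j (ltnSn 1)); apply/eqP.
have [x [y [x_gt0 ltxy le_xy_22 btw]]] := additive_triple _ pos_inj.
have x_s : 2 ^ x \in s by apply: pow_s; lia.
have y_s : 2 ^ y \in s by apply: pow_s; lia.
have xy_s : 2 ^ (x + y) \in s by apply: pow_s; lia.
have lt_pow_xy : 2 ^ x < 2 ^ y by rewrite ltn_exp2l.
have lt_pow_y_xy : 2 ^ y < 2 ^ (x + y) by rewrite ltn_exp2l; lia.
case: btw => /andP[lt1 lt2].
- exists [:: 2 ^ x; 2 ^ y; 2 ^ (x + y)]; split=> //.
  + apply: subseq_sorted_index; last by rewrite /= lt1 lt2.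
    by move=> z; rewrite !inE => /or3P[] /eqP->.
  + by rewrite /monotone_seq /= lt_pow_xy lt_pow_y_xy.
  + split; first by rewrite /= !expn_gt0.
    by right; rewrite !big_cons big_nil /= muln1 mulnA -expnD mulnn.
- exists [:: 2 ^ (x + y); 2 ^ y; 2 ^ x]; split=> //.
  + apply: subseq_sorted_index; last by rewrite /= lt1 lt2.
    by move=> z; rewrite !inE => /or3P[] /eqP->.
  + by rewrite /monotone_seq /= lt_pow_xy lt_pow_y_xy orbT.
  + split; first by rewrite /= !expn_gt0.
    by left; rewrite !big_cons big_nil /= muln1 -expnD addnC mulnn addnC.
Qed.

Lemma mem_one_line (n : nat) (p : 'S_n) (v : nat) :
  0 < v <= n -> v \in one_line p.
Proof.
case/andP=> v_gt0 le_vn; have v1_lt : v.-1 < n by rewrite prednK.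
apply/mapP; exists ((p^-1)%g (Ordinal v1_lt)); first by rewrite mem_enum.
by rewrite permKV /= prednK.
Qed.

Theorem corollary6p3 :
  exists N : nat, forall n : nat, N <= n -> forall p : 'S_n,
    exists a : seq nat,
      [/\ subseq a (one_line p), size a = 3, monotone_seq a
        & two_multiplicative a].
Proof.
exists (2 ^ 22) => n le_n p; apply: multiplicative_triple => k /andP[_ le_k].
apply: mem_one_line; rewrite expn_gt0 /=.
by apply: leq_trans le_n; rewrite leq_exp2l.
Qed.
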